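(* Let $C$ be a closed set in $\mathbb{R}^{m\times n}$. Let $r^*=\min\{\operatorname{rank}(X):X\in C\}$ and, for given $\varepsilon>0$, let $\phi^*_\varepsilon$ and $X(\varepsilon)$ be respectively the optimal value and an optimal solution of the problem $$\text{minimize } \phi_\varepsilon(X)=\operatorname{tr}\left(X(X^TX+\varepsilon I)^{-1}X^T\right)\quad\text{subject to } X\in C.$$ Then $\phi^*_\varepsilon\le r^*$ for any $\varepsilon>0$. Moreover, when $C$ is bounded, then $\lim_{\varepsilon\to0}\phi^*_\varepsilon=r^*$, and any accumulation point of $X(\varepsilon)$, as $\varepsilon\to0$, is a minimum rank solution, i.e. a minimizer of $\operatorname{rank}(X)$ over $X\in C$.
   Context: $I$ is the $n\times n$ identity matrix. The limit $\varepsilon\to0$ is taken through $\varepsilon>0$. *)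

(* Defs.v *)
From HB Require Import structures.
From mathcomp Require Import all_boot all_order all_algebra.
From mathcomp Require Import all_classical all_reals all_analysis.

Set Implicit Arguments.
Unset Strict Implicit.
Unset Printing Implicit Defensive.

Import Order.TTheory GRing.Theory Num.Theory.
Import numFieldNormedType.Exports.

Local Open Scope classical_set_scope.
Local Open Scope ring_scope.

Definition minimizer (T : Type) (d : Order.disp_t) (S : porderType d)
    (f : T -> S) (C : set T) (x : T) : Prop :=
  C x /\ forall y : T, C y -> (f x <= f y)%O.

(* For 0 < eps the matrix X^T X + eps I is positive definite, hence in
   unitmx, so invmx is its inverse. *)
Definition phi (R : realType) (m n : nat) (eps : R) (X : 'M[R]_(m, n)) : R :=
  \tr (X *m invmx (X^T *m X + eps%:M) *m X^T).

(* phi eps is nonnegative for 0 < eps, so on a nonempty C this real infimum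
   is the genuine one; it is a minimum exactly when an optimal solution
   exists, which need not be the case if C is unbounded. *)
Definition phi_opt (R : realType) (m n : nat) (C : set 'M[R]_(m, n))
    (eps : R) : R :=
  inf [set phi eps X | X in C].

Lemma rank_value_ex (R : realType) (m n : nat) (C : set 'M[R]_(m, n)) :
  C !=set0 -> exists r : nat, `[< exists2 X, C X & \rank X = r >].
Proof. by move=> [X CX]; exists (\rank X); apply/asboolP; exists X. Qed.

Definition min_rank (R : realType) (m n : nat) (C : set 'M[R]_(m, n))
    (C0 : C !=set0) : nat :=
  ex_minn (rank_value_ex C0).

(* Main.v *)
(* For every m x n matrix W,
     phi_eps(X) >= 2 tr(W X^T) - |W X^T|^2 - eps |W|^2   (Frobenius norms),
   with equality at W = X (X^T X + eps I)^-1.  For A in C, taking W^T to be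
   the pseudo-inverse of A makes the right-hand side jointly continuous in
   (X, eps) with value rank A at (A, 0), so phi_eps(X) > rank A - d near
   (A, 0^+).  Together with phi_eps(X) <= rank X, this local bound settles
   accumulation points directly, and compactness of C makes it uniform, whence
   the limit. *)
Require Import Defs.
From HB Require Import structures.
From mathcomp Require Import all_boot all_order all_algebra.
From mathcomp Require Import all_classical all_reals all_analysis.
From mathcomp Require Import lra.

Set Implicit Arguments.
Unset Strict Implicit.
Unset Printing Implicit Defensive.

Import Order.TTheory GRing.Theory Num.Theory.
Import numFieldNormedType.Exports.

Local Open Scope classical_set_scope.
Local Open Scope ring_scope.

(** * Frobenius norms, Gram matrices and orthogonal projectors *)

Section Frobenius.
Variable R : realFieldType.

Lemma mxtrace_mul_tr m n (A : 'M[R]_(m, n)) :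
  \tr (A *m A^T) = \sum_i \sum_j A i j ^+ 2.
Proof. by apply: eq_bigr => i _; rewrite mxE; apply: eq_bigr => j _; rewrite mxE. Qed.

Lemma mxtrace_mul_tr_ge0 m n (A : 'M[R]_(m, n)) : 0 <= \tr (A *m A^T).
Proof.
by rewrite mxtrace_mul_tr; do 2![apply: sumr_ge0 => ? _]; exact: sqr_ge0.
Qed.

Lemma mxtrace_mul_tr_eq0 m n (A : 'M[R]_(m, n)) : \tr (A *m A^T) = 0 -> A = 0.
Proof.
rewrite mxtrace_mul_tr => /eqP.
rewrite psumr_eq0 => [/allP A0|i _]; last by apply: sumr_ge0 => j _; exact: sqr_ge0.
apply/matrixP => i j; rewrite mxE; apply/eqP; rewrite -sqrf_eq0.
have := A0 i (mem_index_enum _).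
by rewrite /= psumr_eq0 => [/allP/(_ j (mem_index_enum _))//|? _]; exact: sqr_ge0.
Qed.

(** If [v *m G *m G^T = 0] then [|v G|^2 = v G G^T v^T = 0], and freeness of [G] kills [v]. *)
Lemma gram_unit m n (G : 'M[R]_(m, n)) : row_free G -> G *m G^T \in unitmx.
Proof.
move=> freeG; rewrite -row_free_unit; apply: inj_row_free => v vGG.
apply: (row_free_inj freeG); rewrite mul0mx; apply: mxtrace_mul_tr_eq0.
by rewrite trmx_mul mulmxA -(mulmxA v) vGG mul0mx mxtrace0.
Qed.

Lemma mxtrace_regularized m n p (eps : R) (X : 'M[R]_(m, n)) (W : 'M[R]_(p, n)) :
  \tr (W *m (X^T *m X + eps%:M) *m W^T) =
  \tr (W *m X^T *m (W *m X^T)^T) + eps * \tr (W *m W^T).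
Proof.
rewrite mulmxDr mulmxDl mxtraceD mul_mx_scalar -scalemxAl mxtraceZ.
by rewrite trmx_mul trmxK !mulmxA.
Qed.

(** Positive definiteness: [v S = 0] gives [0 = \tr (v S v^T) = |v X^T|^2 + eps |v|^2], which forces
    [v = 0]. *)
Lemma regularized_unit m n (eps : R) (X : 'M[R]_(m, n)) :
  0 < eps -> X^T *m X + eps%:M \in unitmx.
Proof.
move=> eps0; rewrite -row_free_unit; apply: inj_row_free => v vS.
apply: mxtrace_mul_tr_eq0; apply/eqP; rewrite eq_le mxtrace_mul_tr_ge0 andbT.
rewrite -(pmulr_rle0 _ eps0) -[leRHS](mxtrace0 R 1) -(mul0mx _ v^T) -vS.
by rewrite mxtrace_regularized lerDr mxtrace_mul_tr_ge0.
Qed.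

Lemma regularized_sym m n (eps : R) (X : 'M[R]_(m, n)) :
  (X^T *m X + eps%:M)^T = X^T *m X + eps%:M.
Proof. by rewrite linearD /= trmx_mul trmxK tr_scalar_mx. Qed.

Lemma col_base_free m n (X : 'M[R]_(m, n)) : row_free (col_base X)^T.
Proof. by rewrite /row_free mxrank_tr; exact: col_base_full. Qed.

(** With the full-rank factorization [X = B G], take [Q = B (B^T B)^-1 B^T]; cyclicity turns its
    trace into that of the identity of size [\rank X]. *)
Lemma column_projector_ex m n (X : 'M[R]_(m, n)) : exists Q : 'M[R]_m,
  [/\ Q *m Q = Q, Q^T = Q, Q *m X = X & \tr Q = (\rank X)%:R].
Proof.
have := mulmx_base X; have := gram_unit (col_base_free X); rewrite trmxK.
move: (col_base X) (row_base X) => B G uB BG.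
have BK p (Z : 'M[R]_(p, _)) : Z *m invmx (B^T *m B) *m B^T *m B = Z.
  by rewrite -(mulmxA _ B^T) mulmxKV.
exists (B *m invmx (B^T *m B) *m B^T); split.
- by rewrite !mulmxA BK.
- by rewrite !trmx_mul trmxK trmx_inv trmx_mul trmxK mulmxA.
- by rewrite -[X in _ *m X = _]BG !mulmxA BK BG.
- by rewrite mxtrace_mulC mulmxA mulmxV// mxtrace1.
Qed.

(* [W^T] is the Moore-Penrose inverse of [A], so that [W *m A^T] is the
   orthogonal projector onto the column space of [A]. *)
Lemma trmx_pinv_ex m n (A : 'M[R]_(m, n)) : exists W : 'M[R]_(m, n),
  \tr (W *m A^T) = (\rank A)%:R /\
  \tr (W *m A^T *m (W *m A^T)^T) = (\rank A)%:R.
Proof.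
have uG := gram_unit (row_base_free A).
have := mulmx_base A; have := gram_unit (col_base_free A); rewrite trmxK.
move: (col_base A) (row_base A) uG => B G uG uB BG.
(* In [W *m A^T] the factor [G *m G^T] cancels, leaving the projector [B (B^T B)^-1 B^T]. *)
exists (B *m invmx (B^T *m B) *m invmx (G *m G^T) *m G).
have -> : A^T = G^T *m B^T by rewrite -trmx_mul BG.
have symB : (B^T *m B)^T = B^T *m B by rewrite trmx_mul trmxK.
rewrite !mulmxA -(mulmxA _ G) mulmxKV//; split.
  by rewrite mxtrace_mulC mulmxA mulmxV// mxtrace1.
rewrite !trmx_mul trmxK trmx_inv symB !mulmxA -(mulmxA _ B^T B) mulmxKV//.
by rewrite mxtrace_mulC mulmxA mulmxV// mxtrace1.
Qed.

End Frobenius.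

(** * Lower and upper bounds on [phi] *)

Section PhiBounds.
Variable R : realType.

(* The gap is [\tr ((W - V) S (W - V)^T)] with [S := X^T X + eps I] and
   [V := X S^-1]. *)
Lemma phi_ge m n (eps : R) (X W : 'M[R]_(m, n)) : 0 < eps ->
  \tr (W *m X^T) *+ 2 - \tr (W *m X^T *m (W *m X^T)^T) - eps * \tr (W *m W^T)
  <= phi eps X.
Proof.
move=> eps0; rewrite /phi -addrA -opprD -mxtrace_regularized.
have uS := regularized_unit X eps0; have symS := regularized_sym eps X.
have : 0 <= \tr ((W - X *m invmx (X^T *m X + eps%:M)) *m (X^T *m X + eps%:M) *m
                 (W - X *m invmx (X^T *m X + eps%:M))^T).
  rewrite mxtrace_regularized addr_ge0 ?mxtrace_mul_tr_ge0//.
  by rewrite mulr_ge0 ?mxtrace_mul_tr_ge0// ltW.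
move: (_ + _%:M) => S in uS symS *.
rewrite mulmxBl mulmxKV// linearB/= trmx_mul trmx_inv symS mulmxBr.
rewrite !mulmxBl !mulmxA mulmxK// !raddfB/=.
have -> : \tr (X *m W^T) = \tr (W *m X^T) by rewrite -mxtrace_tr trmx_mul trmxK.
lra.
Qed.

Lemma phi_ge0 m n (eps : R) (X : 'M[R]_(m, n)) : 0 < eps -> 0 <= phi eps X.
Proof.
move=> eps0; apply: le_trans (phi_ge X 0 eps0).
by rewrite !mul0mx mxtrace0 mulr0 mul0rn !subr0.
Qed.

(* [\rank X - phi eps X] is [|Q - V X^T|^2 + eps |V|^2] for [V := X S^-1] and
   [Q] the orthogonal projector onto the column space of [X]. *)
Lemma phi_le_rank m n (eps : R) (X : 'M[R]_(m, n)) : 0 < eps ->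
  phi eps X <= (\rank X)%:R.
Proof.
move=> eps0; have [Q [QQ Qt QX trQ]] := column_projector_ex X.
have uS := regularized_unit X eps0.
rewrite /phi; set V := X *m invmx _.
have VS : V *m (X^T *m X + eps%:M) = X by rewrite mulmxKV.
(* The left-hand side is [phi eps X]. Both cross terms of [|Q - V X^T|^2] equal it too, because [Q]
   fixes [X]. *)
have trV : \tr (V *m X^T) = \tr (V *m X^T *m (V *m X^T)^T) + eps * \tr (V *m V^T).
  by rewrite -mxtrace_regularized VS -[LHS]mxtrace_tr trmx_mul trmxK.
have := mxtrace_mul_tr_ge0 (Q - V *m X^T).
have := mulr_ge0 (ltW eps0) (mxtrace_mul_tr_ge0 V).
rewrite linearB /= mulmxBr !mulmxBl !raddfB /= Qt QQ trQ.
have -> : \tr (V *m X^T *m Q) = \tr (V *m X^T).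
  by rewrite -mulmxA -{1}Qt -trmx_mul QX.
have -> : \tr (Q *m (V *m X^T)^T) = \tr (V *m X^T).
  by rewrite trmx_mul trmxK mulmxA QX -[LHS]mxtrace_tr trmx_mul trmxK.
lra.
Qed.

End PhiBounds.

(** * Local lower bound and compactness *)

Section Continuity.
Variable R : realType.

Lemma continuous_sum (T : topologicalType) (I : Type) (r : seq I) (f : I -> T -> R) :
  (forall i, continuous (f i)) -> continuous (fun x => \sum_(i <- r) f i x).
Proof.
move=> fc; elim: r => [|i r IH] x.
  by under eq_fun do rewrite big_nil; exact: cvg_cst.
under eq_fun do rewrite big_cons.
by apply: cvgD; [exact: fc|exact: IH].
Qed.

Lemma continuous_mulmx_tr_coord m n p (W : 'M[R]_(m, n)) i k :
  continuous (fun X : 'M[R]_(p, n) => (W *m X^T) i k).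
Proof.
under eq_fun do (rewrite mxE; under eq_bigr do rewrite mxE).
apply: continuous_sum => j X.
apply: (@cvgMl_tmp _ _ (nbhs X) _ (fun Y : 'M[R]_(p, n) => Y k j)).
exact: coord_continuous.
Qed.

Lemma rank_lt_phi_near m n (A : 'M[R]_(m, n)) (d : R) : 0 < d ->
  \forall X \near A & eps \near 0^'+, (\rank A)%:R - d < phi eps X.
Proof.
move=> d0; have [W [trWA trWAWA]] := trmx_pinv_ex A.
pose g (X : 'M[R]_(m, n)) := \tr (W *m X^T) *+ 2 - \tr (W *m X^T *m (W *m X^T)^T).
have gA : g A = (\rank A)%:R by rewrite /g trWA trWAWA mulr2n addrK.
have gc : continuous g.
  have coordc i k := @continuous_mulmx_tr_coord m n m W i k.
  have trc : continuous (fun X : 'M[R]_(m, n) => \tr (W *m X^T)).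
    by apply: continuous_sum => i; exact: coordc.
  have sqc : continuous (fun X : 'M[R]_(m, n) => \tr (W *m X^T *m (W *m X^T)^T)).
    under eq_fun do rewrite mxtrace_mul_tr.
    apply: continuous_sum => i; apply: continuous_sum => j X.
    exact: continuousM (coordc i j X) (coordc i j X).
  by move=> X; exact: continuousB (continuousD (trc X) (trc X)) (sqc X).
have c0 := mxtrace_mul_tr_ge0 W; set c := \tr (W *m W^T) in c0.
(* Half of [d] pays for the variation of [g], half for [eps * c]; the denominator [c + 1] stays
   positive when [W = 0]. *)
exists ([set X | (\rank A)%:R - d / 2 < g X],
        [set eps | 0 < eps /\ eps < d / 2 / (c + 1)]); first split.
- rewrite /=; near=> X; near: X.
  by apply: (cvgr_gt (g A)); [exact: gc|rewrite gA; lra].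
- rewrite /=; apply: filterI; first exact: nbhs_right_gt.
  by apply: nbhs_right_lt; rewrite divr_gt0//; lra.
- move=> [X eps] [/= gX [eps0]]; rewrite ltr_pdivlMr; last by lra.
  move=> epsc; apply: lt_le_trans (phi_ge X W eps0); rewrite -/(g X) -/c; nra.
Unshelve. all: by end_near. Qed.

(** Heine-Borel is carried over from row vectors by [vec_mx], which only rearranges entries and so
    preserves balls and the max norm. *)
Lemma matrix_bounded_closed_compact m n (C : set 'M[R]_(m, n)) :
  bounded_set C -> closed C -> compact C.
Proof.
move=> [M [Mreal CM]] Ccl.
have vec_continuous : continuous (vec_mx : 'rV[R]_(m * n) -> 'M[R]_(m, n)).
  move=> v s /(nbhs_ballP (vec_mx v)) [e e0 es].
  apply/nbhs_ballP; exists e => //= w [_ vw]; apply: es.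
  by split=> // i j; rewrite !mxE; exact: vw.
have -> : C = vec_mx @` (vec_mx @^-1` C).
  by rewrite image_preimage// -subTset => X _; exists (mxvec X) => //; exact: mxvecK.
apply: continuous_compact; first exact: continuous_subspaceT.
apply: bounded_closed_compact; last exact: preimage_closed.
exists M; split=> // N MN v /= Cv; apply: le_trans (CM _ MN _ Cv).
rewrite [leLHS]/Num.norm [leRHS]/Num.norm /= !mx_normrE.
apply/bigmax_leP; split=> [|[i k] _ /=]; first exact: bigmax_ge_id.
case/mxvec_indexP: k => a b; rewrite (ord1 i).
by apply/bigmax_geP; right; exists (a, b); rewrite //= mxE.
Qed.

End Continuity.

(** * Minimum rank, optimal value and the theorem *)

Lemma min_rank_attained (R : realType) m n (C : set 'M[R]_(m, n)) (C0 : C !=set0) :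
  exists2 X, C X & \rank X = min_rank C0.
Proof. by rewrite /min_rank; case: ex_minnP => r /asboolP. Qed.

Lemma min_rank_le (R : realType) m n (C : set 'M[R]_(m, n)) (C0 : C !=set0) X :
  C X -> (min_rank C0 <= \rank X)%N.
Proof.
move=> CX; rewrite /min_rank; case: ex_minnP => r _; apply.
by apply/asboolP; exists X.
Qed.

Lemma phi_opt_le (R : realType) m n (C : set 'M[R]_(m, n)) (eps : R) X :
  0 < eps -> C X -> phi_opt C eps <= phi eps X.
Proof.
move=> eps0 CX; apply: ge_inf; last by exists X.
by exists 0 => _ [Y _ <-]; exact: phi_ge0.
Qed.

Lemma phi_opt_le_min_rank (R : realType) m n (C : set 'M[R]_(m, n))
    (C0 : C !=set0) (eps : R) :
  0 < eps -> phi_opt C eps <= (min_rank C0)%:R.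
Proof.
move=> eps0; have [X CX <-] := min_rank_attained C0.
exact: le_trans (phi_opt_le eps0 CX) (phi_le_rank X eps0).
Qed.

Theorem theorem2p6 (R : realType) (m n : nat) (C : set 'M[R]_(m, n))
    (Cclosed : closed C) (C0 : C !=set0) :
  (forall eps : R, 0 < eps -> phi_opt C eps <= (min_rank C0)%:R) /\
  (bounded_set C ->
    (phi_opt C eps @[eps --> 0^'+] --> ((min_rank C0)%:R : R)) /\
    (forall X : R -> 'M[R]_(m, n),
      (forall eps : R, 0 < eps -> minimizer (phi eps) C (X eps)) ->
      forall A : 'M[R]_(m, n), cluster (X eps @[eps --> 0^'+]) A ->
        minimizer (fun Y : 'M[R]_(m, n) => \rank Y) C A)).
Proof.
split=> [eps|Cbnd]; first exact: phi_opt_le_min_rank.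
split=> [|X Xmin A clA].
  apply/cvgrPdist_le => d d0.
  have Ccpt := matrix_bounded_closed_compact Cbnd Cclosed.
  (* Compactness in its near-covering form merges the local bounds into one range of [eps] valid on
     all of [C]. *)
  have near_opt : \forall eps \near 0^'+,
      C `<=` [set X | (min_rank C0)%:R - d < phi eps X].
    apply: (compact_near_coveringP C).1 Ccpt _ _
      (fun eps X => (min_rank C0)%:R - d < phi eps X) _ _ => A CA.
    have [[U V] /= [AU V0] UV] := rank_lt_phi_near A d0.
    exists (U, V) => // -[X eps] UVX; apply: le_lt_trans (UV _ UVX).
    by rewrite lerB// ler_nat min_rank_le.
  near=> eps.
  have eps0 : 0 < eps by near: eps; exact: nbhs_right_gt.
  rewrite ger0_norm ?subr_ge0 ?phi_opt_le_min_rank// lerBlDr -lerBlDl.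
  apply: lb_le_inf; first by have [X CX] := C0; exists (phi eps X), X.
  move=> _ [X CX <-]; apply/ltW; move: X CX; near: eps; exact: near_opt.
have CA : C A.
  apply: Cclosed => U AU.
  suff CX : \forall eps \near 0^'+, C (X eps).
    by have [Y [CY UY]] := clA C U CX AU; exists Y.
  by near=> eps; apply: (Xmin eps _).1; near: eps; exact: nbhs_right_gt.
split=> // Y CY; apply: leq_trans (min_rank_le C0 CY).
(* Ranks are integers, so [\rank A < min_rank C0 + 1] suffices and the local bound is used with
   [d = 1]. *)
rewrite -ltnS -(ltr_nat R) mulrSr.
have [[U V] /= [AU V0] UV] := rank_lt_phi_near A (@ltr01 R).
(* A cluster point only yields a matrix near [A]; membership in [P] recovers a positive [e] in [V]
   that produced it. *)
pose P := [set X e | e in [set e | 0 < e /\ V e]].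
suff PX : \forall eps \near 0^'+, P (X eps).
  have [_ [[e [e0 Ve] <-] UX]] := clA P U PX AU.
  rewrite -ltrBlDr; apply: lt_le_trans (UV (X e, e) _) _ => //=.
  have [Z CZ <-] := min_rank_attained C0.
  exact: le_trans ((Xmin e e0).2 Z CZ) (phi_le_rank Z e0).
near=> eps; exists eps => //; split; near: eps; [exact: nbhs_right_gt|exact: V0].
Unshelve. all: by end_near. Qed.
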